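(* Let $d\in\{2,3\}$ and let $f$ be an energy density satisfying the Energy Density Assumption on the interval $I$ (see context). Let $\Gamma^m$, $H^m\in\mathbb K^m$ and $\tau_m>0$ be given, and suppose that $$(\boldsymbol X^{m+1},\mu^{m+1},H^{m+1},r^{m+1})\in[\mathbb K^m]^d\times(\mathbb K^m)^3$$ satisfies, for all $\varphi,\psi,\zeta\in\mathbb K^m$ and all $\boldsymbol\omega\in[\mathbb K^m]^d$, $$\Big(\tfrac{\delta\boldsymbol X^{m+1}}{\tau_m}\cdot\boldsymbol n^m,\varphi\Big)^h_{\Gamma^m}=-(\mu^{m+1},\varphi)^h_{\Gamma^m},$$ $$(\mu^{m+1}\boldsymbol n^m,\boldsymbol\omega)^h_{\Gamma^m}=\mathcal D^k_m(\boldsymbol X^{m+1},\boldsymbol\omega;H^{m+1})+\mathcal B_m(\boldsymbol\omega,r^{m+1}),$$ $$(\delta H^{m+1},\psi)^h_{\Gamma^m}=\mathcal B_m(\delta\boldsymbol X^{m+1},\psi),$$ $$(r^{m+1},\zeta)^h_{\Gamma^m}=(f_H(\boldsymbol n^m,H^{m+1}),\zeta)^h_{\Gamma^m},$$ where the stabilizing function $k\ge 0$ satisfies $k(\boldsymbol n^m_j,H^{m+1}_{j_\ell})\ge k_0(\boldsymbol n^m_j,H^{m+1}_{j_\ell})$ for $1\le j\le J$, $1\le \ell\le d$. Assume that all elements $\sigma_j^m$ of $\Gamma^m$ and $\sigma_j^{m+1}$ of $\Gamma^{m+1}$ are nondegenerate and that all nodal values satisfy $H^m_i,H^{m+1}_i\in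 I$. Then $$W^{m+1}+\tau_m\|\mu^{m+1}\|_{m,h}^2\le W^m .$$ This holds for every $\tau_m>0$.
   Context: **Density.** $d\in\{2,3\}$, $I\subseteq\mathbb R$ is an interval, $f:\mathbb S^{d-1}\times\mathbb R\to\mathbb R_{>0}$; $f_H$ is the derivative of $f$ in its second argument, and $\boldsymbol a(\boldsymbol n,s)=\nabla_{\mathbb S^{d-1}}f(\boldsymbol n,s)$ is the spherical (tangential) gradient in the first argument with $s$ fixed. *Energy Density Assumption on $I$:* for every $s\in I$, $f(\cdot,s)$ is positive and in $C^2(\mathbb S^{d-1})$, and $(5-d)f(\boldsymbol n,s)-f(-\boldsymbol n,s)\ge 0$ for all $(\boldsymbol n,s)\in\mathbb S^{d-1}\times I$; and for each $\boldsymbol n\in\mathbb S^{d-1}$, $s\mapsto f(\boldsymbol n,s)$ is continuously differentiable and convex on $I$. **Surface energy matrix.** With $\boldsymbol\xi(\boldsymbol n,s)=f(\boldsymbol n,s)\boldsymbol n+\boldsymbol a(\boldsymbol n,s)$ and a stabilizing function $k:\mathbb S^{d-1}\times I\to[0,\infty)$, $$\boldsymbol Z_k(\boldsymbol n,s)=f(\boldsymbol n,s)I_d-\boldsymbol n\boldsymbol\xi^T-\boldsymbol\xi\boldsymbol n^T+k(\boldsymbol n,s)\boldsymbol n\boldsymbol n^T .$$ **Discrete surfaces.** An oriented $(d-1)$-simplex $\sigma=[\boldsymbol q_1,\dots,\boldsymbol q_d]\subset\mathbb R^d$ (segment for $d=2$, triangle for $d=3$) has orientation vector $\mathcal J\{\sigma\}=(\boldsymbol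 q_2-\boldsymbol q_1)^\perp$ for $d=2$, where $(v_1,v_2)^\perp=(v_2,-v_1)$, and $\mathcal J\{\sigma\}=(\boldsymbol q_2-\boldsymbol q_1)\times(\boldsymbol q_3-\boldsymbol q_1)$ for $d=3$; its measure is $|\sigma|=|\mathcal J\{\sigma\}|/(d-1)$ and its unit normal is $\mathcal J\{\sigma\}/|\mathcal J\{\sigma\}|$. Nondegenerate means $|\sigma|>0$. $\Gamma^m=\bigcup_{j=1}^J\overline{\sigma^m_j}$, $\sigma^m_j=[\boldsymbol q^m_{j_1},\dots,\boldsymbol q^m_{j_d}]$, is a closed polygonal curve ($d=2$) or closed triangulated surface ($d=3$) with vertex orderings consistent with the outward orientation; $\boldsymbol n^m$ is the piecewise constant normal with value $\boldsymbol n^m_j$ on $\sigma^m_j$. $\mathbb K^m$ is the space of continuous functions on $\Gamma^m$ that are affine on each element. For $u$ affine on a simplex, $\nabla_{\Gamma^m}u$ is its constant tangential gradient; for vector fields $(\nabla_{\Gamma^m}\boldsymbol w)$ has rows $(\nabla_{\Gamma^m}w_i)^T$. $\boldsymbol X^m=\mathrm{id}$ on $\Gamma^m$. $\boldsymbol X^{m+1}\in[\mathbb K^m]^d$ maps each vertex $\boldsymbol q^m_i$ to $\boldsymbol q^{m+1}_i$, and $\Gamma^{m+1}$ has the same connectivity, with elements $\sigma_j^{m+1}=[\boldsymbol q^{m+1}_{j_1},\dots,\boldsymbol q^{m+1}_{j_d}]$ and normals $\boldsymbol n_j^{m+1}$. $\delta\boldsymbol X^{m+1}=\boldsymbol X^{m+1}-\boldsymbol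 X^m$, $\delta H^{m+1}=H^{m+1}-H^m$. Nodal values $H^{m+1}_i$ are carried to the corresponding vertices of $\Gamma^{m+1}$; $H_{j_\ell}$ is the nodal value at the $\ell$th vertex of element $j$. **Quadrature.** For piecewise continuous $u,v$ with $u_{j\ell}$ the limit of $u$ at $\boldsymbol q^m_{j_\ell}$ from inside $\sigma^m_j$, $$(u,v)^h_{\Gamma^m}=\frac1d\sum_{j=1}^J\sum_{\ell=1}^d|\sigma^m_j|\,u_{j\ell}v_{j\ell},\qquad \|u\|^2_{m,h}=(u,u)^h_{\Gamma^m},$$ with the dot product for vectors; $\langle\cdot,\cdot\rangle^h_{\Gamma^m}$ is the same with the Frobenius product $U:V=\mathrm{tr}(U^TV)$ for matrices. Nonlinear coefficients are evaluated at traces, e.g. $f_H(\boldsymbol n^m,H^{m+1})_{j\ell}=f_H(\boldsymbol n^m_j,H^{m+1}_{j_\ell})$, and likewise for $\boldsymbol Z_k$. **Forms.** At vertex $i$ let $\mathcal T^m_i$ be the indices of incident elements and $\boldsymbol N^m_i=\sum_{j\in\mathcal T^m_i}|\sigma^m_j|\boldsymbol n^m_j\big/\big|\sum_{j\in\mathcal T^m_i}|\sigma^m_j|\boldsymbol n^m_j\big|$ (denominator assumed nonzero), and let $\boldsymbol N^m\in[\mathbb K^m]^d$ interpolate these values. On each element, $\boldsymbol P^m=I_d-\boldsymbol n^m(\boldsymbol n^m)^T$ and $\boldsymbol A^m=\boldsymbol P^m\,\tfrac12\big(\nabla_{\Gamma^m}\boldsymbol N^m+(\nabla_{\Gamma^m}\boldsymbol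 N^m)^T\big)\boldsymbol P^m$. Define $$\mathcal B_m(\boldsymbol w,\psi)=\langle\boldsymbol n^m(\nabla_{\Gamma^m}\psi)^T-\psi\boldsymbol A^m,\nabla_{\Gamma^m}\boldsymbol w\rangle^h_{\Gamma^m},$$ $$\mathcal D^k_m(\boldsymbol Y,\boldsymbol\omega;H)=\langle\boldsymbol Z_k(\boldsymbol n^m,H)\nabla_{\Gamma^m}\boldsymbol Y,\nabla_{\Gamma^m}\boldsymbol\omega\rangle^h_{\Gamma^m}.$$ **Threshold $k_0$.** $k_0:\mathbb S^{d-1}\times I\to[0,\infty)$ is a threshold function with the following property (such a finite $k_0$ exists for densities satisfying the Assumption): for every $s\in I$, every oriented nondegenerate $(d-1)$-simplex $\sigma$ with normal $\boldsymbol n$, every affine map $\boldsymbol X$ of $\sigma$ onto a nondegenerate simplex $\bar\sigma$ preserving the vertex ordering, with induced normal $\bar{\boldsymbol n}$, and every value $k(\boldsymbol n,s)\ge k_0(\boldsymbol n,s)$, $$|\sigma|\,\big(\boldsymbol Z_k(\boldsymbol n,s)\nabla_\sigma\boldsymbol X\big):\big(\nabla_\sigma\boldsymbol X-\nabla_\sigma\mathrm{id}\big)\ge|\bar\sigma|f(\bar{\boldsymbol n},s)-|\sigma|f(\boldsymbol n,s),$$ where $\nabla_\sigma$ is the tangential Jacobian on $\sigma$ (so $\nabla_\sigma\mathrm{id}=I_d-\boldsymbol n\boldsymbol n^T$). **Discrete energy.** $W^m=\frac1d\sum_{j=1}^J|\sigma^m_j|\sum_{\ell=1}^d f(\boldsymbol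 n^m_j,H^m_{j_\ell})$, and $W^{m+1}$ is the same expression with $\sigma^{m+1}_j,\boldsymbol n^{m+1}_j,H^{m+1}_{j_\ell}$. *)

(* Defs.v *)
From HB Require Import structures.
From mathcomp Require Import all_boot all_order all_algebra.
From mathcomp Require Import all_classical all_reals.
From mathcomp Require Import topology normedtype derive convex.

Set Implicit Arguments.
Unset Strict Implicit.
Unset Printing Implicit Defensive.
Import Order.TTheory GRing.Theory Num.Theory.
Import numFieldNormedType.Exports.
Local Open Scope classical_set_scope.
Local Open Scope ring_scope.

Section Euclid.
Context {R : realType}.

Definition frob {m n : nat} (U V : 'M[R]_(m, n)) : R := \tr (U^T *m V).

Definition dot {d : nat} (u v : 'cV[R]_d) : R := \sum_i u i 0 * v i 0.

(* The library norm on ['cV[R]_d] is the sup norm; [enorm] is the Euclidean one. *)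
Definition enorm {d : nat} (u : 'cV[R]_d) : R := Num.sqrt (dot u u).

Definition sphere (d : nat) : set 'cV[R]_d := [set n | enorm n = 1].

Definition conv_hull {d : nat} {T : finType} (p : T -> 'cV[R]_d) (S : {set T})
    : set 'cV[R]_d :=
  [set x | exists c : T -> R,
    [/\ forall i, 0 <= c i, forall i, i \notin S -> c i = 0,
        \sum_i c i = 1 & x = \sum_i c i *: p i]].

Definition affine_on {d : nat} (A : set 'cV[R]_d) (u : 'cV[R]_d -> R) : Prop :=
  exists (b : 'cV[R]_d) (c : R), forall x, A x -> u x = dot b x + c.

End Euclid.

Section Calculus.
Context {R : realType}.

Definition partial {d : nat} (i : 'I_d) (F : 'cV[R]_d -> R) : 'cV[R]_d -> R :=
  fun x => 'D_(delta_mx i 0) F x.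

Fixpoint Ck_on {d : nat} (k : nat) (U : set 'cV[R]_d) (F : 'cV[R]_d -> R) : Prop :=
  (forall x, U x -> {for x, continuous F}) /\
  if k is k'.+1 then
    forall i : 'I_d, (forall x, U x -> derivable F x (delta_mx i 0)) /\
                     Ck_on k' U (partial i F)
  else True.

(* Functions on the sphere are represented by functions on R^d of which only the
   values on the sphere are used; calculus on the sphere is that of the extension
   which is constant along rays. *)
Definition radial_ext {d : nat} (g : 'cV[R]_d -> R) : 'cV[R]_d -> R :=
  fun x => g ((enorm x)^-1 *: x).

Definition sphere_C2 {d : nat} (g : 'cV[R]_d -> R) : Prop :=
  Ck_on 2 (~` [set 0]) (radial_ext g).

Definition sphere_grad {d : nat} (g : 'cV[R]_d -> R) (n : 'cV[R]_d) : 'cV[R]_d :=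
  \col_i partial i (radial_ext g) n.

(* Derivative relative to [I]: two-sided at interior points of [I], one-sided at
   the endpoints which belong to [I]. *)
Definition diff_quot_in (I : interval R) (g : R -> R) (s : R) : set_system R :=
  (fun t => (g t - g s) / (t - s)) @ within [set` I] s^'.

Definition derive_in (I : interval R) (g : R -> R) (s : R) : R :=
  lim (diff_quot_in I g s).

Definition C1_in (I : interval R) (g : R -> R) : Prop :=
  (forall s, s \in I -> cvg (diff_quot_in I g s)) /\
  {within [set` I], continuous (derive_in I g)}.

End Calculus.

Section Density.
Context {R : realType} {d : nat}.
Implicit Types (f : 'cV[R]_d -> R -> R) (n : 'cV[R]_d) (I : interval R) (s : R).

Definition energy_density_assumption f I : Prop :=
  [/\ forall s, s \in I -> forall n, sphere n -> 0 < f n s,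
      forall s, s \in I -> sphere_C2 (f ^~ s),
      forall n s, sphere n -> s \in I -> 0 <= (5 - d%:R) * f n s - f (- n) s,
      forall n, sphere n -> C1_in I (f n) &
      forall n, sphere n -> convex_function [set` I] (f n)].

Definition fH f I n s : R := derive_in I (f n) s.

Definition xi_vec f n s : 'cV[R]_d := f n s *: n + sphere_grad (f ^~ s) n.

(* [kappa] is the value of the stabilizing function at [(n, s)]. *)
Definition surface_energy_matrix f (kappa : R) n s : 'M[R]_d :=
  (f n s)%:M - n *m (xi_vec f n s)^T - xi_vec f n s *m n^T + kappa *: (n *m n^T).

End Density.

Section Simplex.
Context {R : realType}.

Definition perp2 (v : 'cV[R]_2) : 'cV[R]_2 :=
  \col_i (if i == 0 then v 1 0 else - v 0 0).

(* Indices in ['I_3] are added modulo 3. *)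
Definition cross3 (v w : 'cV[R]_3) : 'cV[R]_3 :=
  \col_i (v (i + 1) 0 * w (i + 2%:R) 0 - v (i + 2%:R) 0 * w (i + 1) 0).

(* Only the dimensions 2 and 3 are meaningful. *)
Definition orientation_vector {d : nat} : ('I_d -> 'cV[R]_d) -> 'cV[R]_d :=
  match d return ('I_d -> 'cV[R]_d) -> 'cV[R]_d with
  | 2 => fun q => perp2 (q 1 - q 0)
  | 3 => fun q => cross3 (q 1 - q 0) (q 2%:R - q 0)
  | _ => fun _ => 0
  end.

Context {d : nat}.
Implicit Type q : 'I_d -> 'cV[R]_d.

Definition simplex q : set 'cV[R]_d := conv_hull q [set: 'I_d]%SET.

Definition simplex_interior q : set 'cV[R]_d :=
  [set x | exists c : 'I_d -> R,
    [/\ forall i, 0 < c i, \sum_i c i = 1 & x = \sum_i c i *: q i]].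

Definition smeas q : R := enorm (orientation_vector q) / d.-1%:R.

Definition unit_normal q : 'cV[R]_d :=
  (enorm (orientation_vector q))^-1 *: orientation_vector q.

Definition nondegenerate_simplex q : Prop := 0 < smeas q.

(* The constant tangential gradient of a function affine on [q]: the unique
   vector tangent to [q] which represents its increments on [q]. *)
Definition tgrad q (u : 'cV[R]_d -> R) : 'cV[R]_d :=
  get [set g | dot g (unit_normal q) = 0 /\
    forall x y, simplex q x -> simplex q y -> u y - u x = dot g (y - x)].

Definition tjac q (w : 'cV[R]_d -> 'cV[R]_d) : 'M[R]_d :=
  \matrix_(i, c) tgrad q (fun x => w x i 0) c 0.

(* An affine map of [q] onto a simplex preserving the vertex ordering has image
   with ordered vertices [X \o q]. *)
Definition threshold (f : 'cV[R]_d -> R -> R) (I : interval R)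
    (k0 : 'cV[R]_d -> R -> R) : Prop :=
  (forall n s, sphere n -> s \in I -> 0 <= k0 n s) /\
  forall s, s \in I -> forall q (X : 'cV[R]_d -> 'cV[R]_d),
    nondegenerate_simplex q ->
    (forall i, affine_on (simplex q) (fun x => X x i 0)) ->
    nondegenerate_simplex (X \o q) ->
    forall kappa : R, k0 (unit_normal q) s <= kappa ->
    smeas (X \o q) * f (unit_normal (X \o q)) s - smeas q * f (unit_normal q) s
    <= smeas q *
       frob (surface_energy_matrix f kappa (unit_normal q) s *m tjac q X)
            (tjac q X - tjac q id).

End Simplex.

Record mesh (R : realType) (d : nat) := Mesh {
  nvert : nat;
  nelem : nat;
  vert : 'I_nvert -> 'cV[R]_d;
  conn : 'I_nelem -> 'I_d -> 'I_nvert }.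

Arguments vert {R d} m i.
Arguments conn {R d} m j l.

Section Mesh.
Context {R : realType} {d : nat} (M : mesh R d).

Definition elem (j : 'I_(nelem M)) : 'I_d -> 'cV[R]_d :=
  fun l => vert M (conn M j l).

Definition elem_normal (j : 'I_(nelem M)) : 'cV[R]_d := unit_normal (elem j).

Definition elem_verts (j : 'I_(nelem M)) : {set 'I_(nvert M)} :=
  [set conn M j l | l : 'I_d]%SET.

Definition surface : set 'cV[R]_d :=
  [set x | exists j : 'I_(nelem M), simplex (elem j) x].

(* Distinct elements meet exactly in the face spanned by their common vertices. *)
Definition conforming : Prop :=
  [/\ injective (vert M), injective elem_verts &
      forall j k : 'I_(nelem M), simplex (elem j) `&` simplex (elem k) =
        conv_hull (vert M) (elem_verts j :&: elem_verts k)%SET].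

(* Elements around a vertex [i] which share a facet containing [i]. *)
Definition adjacent_at (i : 'I_(nvert M)) : rel 'I_(nelem M) :=
  fun j k => (i \in (elem_verts j :&: elem_verts k)%SET) &&
             (#|(elem_verts j :&: elem_verts k)%SET| == d.-1).

(* Every facet lies in exactly two elements, and the elements around a vertex form
   a single cycle (for d = 2, the two segments issuing from it). *)
Definition closed_manifold : Prop :=
  (forall (j : 'I_(nelem M)) (F : {set 'I_(nvert M)}),
      F \subset elem_verts j -> #|F| = d.-1 ->
      #|[set k : 'I_(nelem M) | F \subset elem_verts k]%SET| = 2) /\
  (forall (i : 'I_(nvert M)) (j k : 'I_(nelem M)),
      i \in elem_verts j -> i \in elem_verts k ->
      connect (adjacent_at i) j k).

(* The surface bounds a bounded open region, and every element normal points out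
   of that region. *)
Definition outward_oriented : Prop :=
  exists Omega : set 'cV[R]_d,
    [/\ open Omega, bounded_set Omega, closure Omega `\` Omega = surface &
        forall (j : 'I_(nelem M)) x, simplex_interior (elem j) x ->
          \forall e \near 0^'+,
            Omega (x - e *: elem_normal j) /\
            ~ closure Omega (x + e *: elem_normal j)].

Definition closed_oriented_surface : Prop :=
  [/\ conforming, closed_manifold & outward_oriented].

End Mesh.

Arguments elem {R d} M j _.
Arguments elem_normal {R d} M j.
Arguments elem_verts {R d} M j.

(* The mesh with the same connectivity whose vertices are moved by [X]. *)
Definition mesh_image {R : realType} {d : nat} (X : 'cV[R]_d -> 'cV[R]_d)
    (M : mesh R d) : mesh R d :=
  Mesh (fun i => X (vert M i)) (conn M).

Section FiniteElements.
Context {R : realType} {d : nat} (M : mesh R d).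
Local Notation V := 'cV[R]_d.

(* Functions on the surface are represented by functions on R^d of which only the
   values on the surface are used. *)
Definition fe_space : set (V -> R) :=
  [set u | {within surface M, continuous u} /\
           forall j : 'I_(nelem M), affine_on (simplex (elem M j)) u].

Definition fe_space_vec : set (V -> V) :=
  [set w | forall i : 'I_d, fe_space (fun x => w x i 0)].

(* A piecewise continuous [T]-valued function on the surface enters the quadrature
   through its traces [u j l] at the [l]-th vertex of element [j]. *)
Definition traces (T : Type) := 'I_(nelem M) -> 'I_d -> T.

(* The traces of a continuous function are its vertex values. *)
Definition nodal_traces (T : Type) (u : V -> T) : traces T :=
  fun j l => u (elem M j l).

Definition quad {T : Type} (ip : T -> T -> R) (u v : traces T) : R :=
  d%:R^-1 * \sum_j \sum_l smeas (elem M j) * ip (u j l) (v j l).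

Definition quad_scal : traces R -> traces R -> R := quad *%R.
Definition quad_vec : traces V -> traces V -> R := quad dot.
Definition quad_mat : traces 'M[R]_d -> traces 'M[R]_d -> R := quad frob.

Definition normal_sum (i : 'I_(nvert M)) : V :=
  \sum_(j : 'I_(nelem M) | i \in elem_verts M j)
    smeas (elem M j) *: elem_normal M j.

Definition vertex_normal (i : 'I_(nvert M)) : V :=
  (enorm (normal_sum i))^-1 *: normal_sum i.

Definition interpolates_vertex_normals (N : V -> V) : Prop :=
  fe_space_vec N /\ forall i : 'I_(nvert M), N (vert M i) = vertex_normal i.

Definition tproj (j : 'I_(nelem M)) : 'M[R]_d :=
  1%:M - elem_normal M j *m (elem_normal M j)^T.

Definition A_mat (N : V -> V) (j : 'I_(nelem M)) : 'M[R]_d :=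
  tproj j *m (2^-1 *: (tjac (elem M j) N + (tjac (elem M j) N)^T)) *m tproj j.

Definition B_form (N : V -> V) (w : V -> V) (psi : V -> R) : R :=
  quad_mat (fun j l => elem_normal M j *m (tgrad (elem M j) psi)^T
                       - psi (elem M j l) *: A_mat N j)
           (fun j _ => tjac (elem M j) w).

Definition D_form (f k : V -> R -> R) (Y w : V -> V) (H : V -> R) : R :=
  quad_mat (fun j l =>
              surface_energy_matrix f (k (elem_normal M j) (H (elem M j l)))
                (elem_normal M j) (H (elem M j l)) *m tjac (elem M j) Y)
           (fun j _ => tjac (elem M j) w).

(* [h] lists the nodal values at the vertices of [M]. *)
Definition discrete_energy (f : V -> R -> R) (h : 'I_(nvert M) -> R) : R :=
  d%:R^-1 * \sum_j smeas (elem M j) * \sum_l f (elem_normal M j) (h (conn M j l)).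

End FiniteElements.

Arguments nodal_traces {R d} M {T} u _ _.
Arguments quad_scal {R d} M u v.
Arguments quad_vec {R d} M u v.
Arguments quad_mat {R d} M u v.
Arguments normal_sum {R d} M i.
Arguments discrete_energy {R d} M f h.

(* Main.v *)
Require Import Defs.
From mathcomp Require Import all_boot all_order all_algebra.
From mathcomp Require Import all_classical all_reals.
From mathcomp Require Import topology normedtype derive convex.
From mathcomp Require Import interval_inference ring lra.
Set Implicit Arguments.
Unset Strict Implicit.
Import Order.TTheory GRing.Theory Num.Theory.
Import numFieldNormedType.Exports.
Local Open Scope classical_set_scope.
Local Open Scope ring_scope.

(** Why the energy decreases.  Write [dX = X - id], [dH = H' - H].  Testing the four
    equations with [phi = mu], [omega = dX], [psi = r] and [zeta = dH] makes the
    terms in [r] and the form [B] cancel, and leaves the balance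
      [- tau |mu|^2 = D(X, dX; H') + (f_H(n, H'), dH)].
    It remains to bound the right-hand side from below by the energy increment,
    which is done separately at each vertex of each element, splitting the
    increment at the intermediate state with old normal and new [H']:
    - the change of geometry at frozen [H'] costs at most the integrand of [D],
      which is the defining property of the threshold [k0];
    - the change of [H] at frozen normal costs at most [f_H(n, H') dH], since the
      convex function [f(n, .)] lies above its tangent line at [H']
      ([convex_tangent_line]).

    The threshold inequality contains [grad X - grad id] and the form [D] contains
    [grad dX].  Their equality ([tjacB]) depends on the tangential gradient being
    uniquely determined by its defining property ([tgrad_unique]): the edges of a
    nondegenerate simplex and its orientation vector span the space
    ([simplex_frame]).  This is where the dimension enters, through the plane
    rotation for [d = 2] and Lagrange's identity for [d = 3]. *)

(** * Euclidean algebra of column vectors *)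

Section DotProduct.
Context {R : realType} {d : nat}.
Implicit Types u v w : 'cV[R]_d.

Lemma dotC u v : dot u v = dot v u.
Proof. by apply: eq_bigr => i _; rewrite mulrC. Qed.

Lemma dotBl u v w : dot (u - v) w = dot u w - dot v w.
Proof. by rewrite /dot -sumrB; apply: eq_bigr => i _; rewrite !mxE mulrBl. Qed.

Lemma dotZl a u v : dot (a *: u) v = a * dot u v.
Proof. by rewrite /dot mulr_sumr; apply: eq_bigr => i _; rewrite mxE mulrA. Qed.

Lemma dotBr u v w : dot u (v - w) = dot u v - dot u w.
Proof. by rewrite dotC dotBl !(dotC u). Qed.

Lemma dotZr a u v : dot u (a *: v) = a * dot u v.
Proof. by rewrite dotC dotZl dotC. Qed.

Lemma dot_suml (T : finType) (c : T -> R) (p : T -> 'cV[R]_d) v :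
  dot (\sum_i c i *: p i) v = \sum_i c i * dot (p i) v.
Proof.
rewrite /dot; under eq_bigr do rewrite summxE mulr_suml.
rewrite exchange_big /=; apply: eq_bigr => i _.
by rewrite mulr_sumr; apply: eq_bigr => k _; rewrite mxE mulrA.
Qed.

Lemma dot_delta i v : dot (delta_mx i 0) v = v i 0.
Proof.
rewrite /dot (bigD1 i) //= big1 ?addr0 ?mxE ?eqxx ?mul1r// => k ki.
by rewrite mxE (negbTE ki) mul0r.
Qed.

Lemma dot_ge0 u : 0 <= dot u u.
Proof. by apply: sumr_ge0 => i _; rewrite -expr2 sqr_ge0. Qed.

Lemma dot_eq0 u : dot u u = 0 -> u = 0.
Proof.
move=> /eqP; rewrite psumr_eq0 => [/allP u0|i _]; last by rewrite -expr2 sqr_ge0.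
apply/matrixP => i j; rewrite ord1 mxE.
by have := u0 i (mem_index_enum i); rewrite /= mulf_eq0 orbb => /eqP.
Qed.

Lemma enorm_sqr u : enorm u ^+ 2 = dot u u.
Proof. by rewrite sqr_sqrtr// dot_ge0. Qed.

Lemma enorm_normalize u : enorm u != 0 -> enorm ((enorm u)^-1 *: u) = 1.
Proof.
move=> u0; rewrite {1}/enorm dotZl dotZr -enorm_sqr expr2 mulKf// mulVf//.
exact: sqrtr1.
Qed.

End DotProduct.

(** * The orientation vector and the edges of a simplex *)

Section Orientation.
Context {R : realType}.

Lemma sum_I2 (F : 'I_2 -> R) : \sum_i F i = F 0 + F 1.
Proof. by rewrite !big_ord_recl big_ord0 addr0; congr (_ + F _); apply: val_inj. Qed.

Lemma sum_I3 (F : 'I_3 -> R) : \sum_i F i = F 0 + F 1 + F 2%:R.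
Proof.
rewrite !big_ord_recl big_ord0 addr0 addrA.
by congr (_ + F _ + F _); apply: val_inj.
Qed.

Lemma I2_cases (l : 'I_2) : l = 0 \/ l = 1.
Proof.
case: l => [[|[|//]] ?]; [left|right]; exact: val_inj.
Qed.

Lemma I3_cases (l : 'I_3) : [\/ l = 0, l = 1 | l = 2%:R].
Proof.
case: l => [[|[|[|//]]] ?];
  [apply: Or31|apply: Or32|apply: Or33]; exact: val_inj.
Qed.

Lemma dot_perp2 (v w : 'cV[R]_2) : dot v (perp2 w) = v 0 0 * w 1 0 - v 1 0 * w 0 0.
Proof. by rewrite /dot sum_I2 !mxE /= mulrN. Qed.

Lemma cross3E (v w : 'cV[R]_3) :
  [/\ cross3 v w 0 0 = v 1 0 * w 2%:R 0 - v 2%:R 0 * w 1 0,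
      cross3 v w 1 0 = v 2%:R 0 * w 0 0 - v 0 0 * w 2%:R 0 &
      cross3 v w 2%:R 0 = v 0 0 * w 1 0 - v 1 0 * w 0 0].
Proof.
by split; rewrite mxE; congr (_ * _ - _ * _); congr (fun_of_matrix _ _ _);
  apply: val_inj.
Qed.

Lemma dot_cross3_self (v w : 'cV[R]_3) :
  dot v (cross3 v w) = 0 /\ dot w (cross3 v w) = 0.
Proof. by rewrite /dot !sum_I3; case: (cross3E v w) => -> -> ->; split; ring. Qed.

(** In the plane [v] and [perp2 v] are orthogonal of equal length. *)
Lemma perp2_pythagoras (g v : 'cV[R]_2) :
  dot g g * dot (perp2 v) (perp2 v) = dot g v ^+ 2 + dot g (perp2 v) ^+ 2.
Proof. by rewrite !dot_perp2 /dot !sum_I2 !mxE /=; ring. Qed.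

(** Lagrange's identity [|g|^2 |J|^2 = (g . J)^2 + |g x J|^2] for [J = v x w],
    with the double product expanded as [g x (v x w) = (g . w) v - (g . v) w]. *)
Lemma cross3_lagrange (g v w : 'cV[R]_3) (e := dot g w *: v - dot g v *: w) :
  dot g g * dot (cross3 v w) (cross3 v w) = dot g (cross3 v w) ^+ 2 + dot e e.
Proof.
by rewrite /e /dot !sum_I3; case: (cross3E v w) => -> -> ->; rewrite !mxE; ring.
Qed.

Context {d : nat} (hd : d = 2%N \/ d = 3%N).
Implicit Type q : 'I_d -> 'cV[R]_d.

Lemma dot_vertex_orientation q :
  exists c, forall l, dot (q l) (orientation_vector q) = c.
Proof.
move: q; case: hd => -> q /=; exists (dot (q 0) (orientation_vector q)) => l;
  apply/eqP; rewrite -subr_eq0 -dotBl; apply/eqP.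
- case: (I2_cases l) => -> /=; rewrite dot_perp2 ?subrr ?mxE; ring.
- have [J1 J2] := dot_cross3_self (q 1 - q 0) (q 2%:R - q 0).
  by case: (I3_cases l) => -> //=; rewrite subrr /dot big1// => i _; rewrite !mxE mul0r.
Qed.

Lemma smeas_gt0 q : (0 < smeas q) = (0 < enorm (orientation_vector q)).
Proof. by rewrite /smeas pmulr_lgt0// invr_gt0 ltr0n; case: hd => ->. Qed.

(** The edges of a nondegenerate simplex together with its orientation vector [J]
    span the whole space, since the two identities above express [|g|^2 |J|^2]
    through the products of [g] with these vectors. *)
Lemma simplex_frame q (g : 'cV[R]_d) : nondegenerate_simplex q ->
  dot g (orientation_vector q) = 0 -> (forall l l', dot g (q l - q l') = 0) ->
  g = 0.
Proof.
rewrite /nondegenerate_simplex smeas_gt0 => J0 gJ gq; apply: dot_eq0.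
have {}J0 : dot (orientation_vector q) (orientation_vector q) != 0.
  by rewrite -enorm_sqr sqrf_eq0 gt_eqF.
apply: (mulIf J0); rewrite mul0r {J0}.
move: q g gJ gq; case: hd => -> q g gJ gq /=.
- by rewrite perp2_pythagoras gq -[perp2 _]/(orientation_vector q) gJ expr0n addr0.
- rewrite cross3_lagrange -[cross3 _ _]/(orientation_vector q) gJ !gq !scale0r subrr.
  by rewrite expr0n add0r /dot big1// => i _; rewrite mxE mul0r.
Qed.

Lemma sphere_unit_normal q : nondegenerate_simplex q -> sphere (unit_normal q).
Proof.
rewrite /nondegenerate_simplex smeas_gt0 => J0.
by rewrite /sphere /=; apply: enorm_normalize; rewrite gt_eqF.
Qed.

(** * Tangential gradients *)

Lemma simplex_vertex q l : simplex q (q l).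
Proof.
exists (fun i => (i == l)%:R); split => [i|i|| ].
- exact: ler0n.
- by rewrite inE.
- by rewrite (bigD1 l) //= eqxx big1 ?addr0// => i /negbTE ->.
- by rewrite (bigD1 l) //= eqxx scale1r big1 ?addr0// => i /negbTE ->; rewrite scale0r.
Qed.

Lemma simplex_tangent q x y : simplex q x -> simplex q y ->
  dot (unit_normal q) (y - x) = 0.
Proof.
have [c qJ] := dot_vertex_orientation q.
suff eqc z : simplex q z -> dot z (orientation_vector q) = c.
  by move=> /eqc xc /eqc yc; rewrite dotZl dotC dotBl xc yc subrr mulr0.
case=> a [_ _ a1 ->]; rewrite dot_suml.
by under eq_bigr do rewrite qJ; rewrite -mulr_suml a1 mul1r.
Qed.

(** An affine function has a tangential gradient: project the gradient of any
    affine extension onto the tangent space. *)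
Lemma tgradP q u : nondegenerate_simplex q -> affine_on (simplex q) u ->
  dot (tgrad q u) (unit_normal q) = 0 /\
  forall x y, simplex q x -> simplex q y -> u y - u x = dot (tgrad q u) (y - x).
Proof.
move=> q0 [b [c ub]]; set n := unit_normal q.
apply: (@getPex _ [set g | dot g n = 0 /\
  forall x y, simplex q x -> simplex q y -> u y - u x = dot g (y - x)]).
exists (b - dot b n *: n); split => /= [|x y qx qy].
  by rewrite dotBl dotZl -enorm_sqr (sphere_unit_normal q0) expr1n mulr1 subrr.
by rewrite dotBl dotZl simplex_tangent// mulr0 subr0 !ub// dotBr; ring.
Qed.

Lemma tgrad_unique q u g : nondegenerate_simplex q -> affine_on (simplex q) u ->
  dot g (unit_normal q) = 0 ->
  (forall x y, simplex q x -> simplex q y -> u y - u x = dot g (y - x)) ->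
  tgrad q u = g.
Proof.
move=> q0 /(tgradP q0)[tn tu] gn gu; apply/eqP; rewrite -subr_eq0; apply/eqP.
apply: (simplex_frame q0) => [|l l'].
  have: dot (tgrad q u - g) (unit_normal q) = 0 by rewrite dotBl tn gn subrr.
  rewrite dotZr => /eqP; rewrite mulf_eq0 invr_eq0.
  by move: q0; rewrite /nondegenerate_simplex smeas_gt0 => /gt_eqF -> /eqP.
by rewrite dotBl -tu -?gu ?subrr//; exact: simplex_vertex.
Qed.

Lemma affine_onB (A : set 'cV[R]_d) u v :
  affine_on A u -> affine_on A v -> affine_on A (fun x => u x - v x).
Proof.
move=> [b [c ub]] [b' [c' vb]]; exists (b - b'), (c - c') => x Ax.
by rewrite dotBl ub// vb//; ring.
Qed.

(** As [tgrad] is obtained by a choice operator, its additivity comes from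
    uniqueness. *)
Lemma tgradB q u v : nondegenerate_simplex q ->
  affine_on (simplex q) u -> affine_on (simplex q) v ->
  tgrad q (fun x => u x - v x) = tgrad q u - tgrad q v.
Proof.
move=> q0 au av; have [un uP] := tgradP q0 au; have [vn vP] := tgradP q0 av.
apply: tgrad_unique => // [||x y qx qy]; first exact: affine_onB.
  by rewrite dotBl un vn subrr.
by rewrite dotBl -uP// -vP//; ring.
Qed.

Lemma tjacB q (v w : 'cV[R]_d -> 'cV[R]_d) : nondegenerate_simplex q ->
  (forall i, affine_on (simplex q) (fun x => v x i 0)) ->
  (forall i, affine_on (simplex q) (fun x => w x i 0)) ->
  tjac q (fun x => v x - w x) = tjac q v - tjac q w.
Proof.
move=> q0 av aw; apply/matrixP => i c; rewrite !mxE.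
under [X in tgrad q X]eq_fun do rewrite !mxE.
by rewrite tgradB// !mxE.
Qed.

Lemma affine_on_coord (A : set 'cV[R]_d) i : affine_on A (fun x => x i 0).
Proof. by exists (delta_mx i 0), 0 => x _; rewrite dot_delta addr0. Qed.

End Orientation.

(** * Finite element functions *)

Section FiniteElementSpace.
Context {R : realType} {d : nat} (M : mesh R d).

Lemma quad_scalC u v : quad_scal M u v = quad_scal M v u.
Proof.
congr (_ * _); apply: eq_bigr => j _; apply: eq_bigr => l _.
by rewrite [u j l * _]mulrC.
Qed.

Lemma fe_spaceB u v :
  fe_space M u -> fe_space M v -> fe_space M (fun x => u x - v x).
Proof.
move=> [uc ua] [vc va]; split => [|j]; last exact: affine_onB.
exact: within_continuousB.
Qed.

Lemma fe_space_vec_id : fe_space_vec M id.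
Proof.
move=> i; split => [|j]; last exact: affine_on_coord.
by apply: continuous_subspaceT; exact: coord_continuous.
Qed.

Lemma fe_space_vecB v w :
  fe_space_vec M v -> fe_space_vec M w -> fe_space_vec M (fun x => v x - w x).
Proof.
move=> hv hw i.
rewrite (_ : (fun x => _) = (fun x => v x i 0 - w x i 0)).
  exact: fe_spaceB.
by apply/funext => x; rewrite !mxE.
Qed.

End FiniteElementSpace.

(** * Tangent lines of convex functions *)

Section Convexity.
Context {R : realType}.

(** As [derive_in] may be one-sided, the proof restricts the difference quotient to
    the segment from [s] to [t].  The points [s + lam (t - s)] with [lam > 0] small
    lie in [I] and tend to [s], so their difference quotients converge to
    [derive_in I g s]; convexity bounds the increments of [g] there by
    [lam (g t - g s)]. *)
Lemma convex_tangent_line (I : interval R) (g : R -> R) s t :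
  convex_function [set` I] g -> cvg (diff_quot_in I g s) ->
  s \in I -> t \in I ->
  derive_in I g s * (t - s) <= g t - g s.
Proof.
move=> cg dg sI tI; have [->|ts] := eqVneq t s; first by rewrite !subrr mulr0.
have {}ts : t - s != 0 by rewrite subr_eq0.
pose h lam : R := s + lam * (t - s).
have hB lam : h lam - s = lam * (t - s) by rewrite /h addrAC subrr add0r.
have hI lam : 0 < lam -> lam < 1 -> h lam \in I.
  move=> l0 l1; have [st|st] := leP s t.
  - apply: (@interval_is_interval _ I s t) => //.
    by rewrite /h; apply/andP; split; nra.
  - apply: (@interval_is_interval _ I t s) => //.
    by rewrite /h; apply/andP; split; nra.
have hs : h @ 0^'+ --> within [set` I] s^'.
  have hc : h @ nbhs 0 --> s.
    rewrite -[X in _ --> X]addr0 -[X in _ + X](mul0r (t - s)).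
    by apply: cvgD; [exact: cvg_cst|apply: cvgMr_tmp; exact: cvg_id].
  move=> A /hc hA.
  have {}hA : \forall lam \near 0^'+, h lam != s -> h lam \in I -> A (h lam).
    have {}hA : nbhs (0 : R) (fun lam => h lam != s -> h lam \in I -> A (h lam)).
      exact: hA.
    by apply: filterS hA => lam hlam _.
  suff: \forall lam \near 0^'+, A (h lam) by [].
  near=> lam.
  have l0 : 0 < lam by near: lam; exact: nbhs_right_gt.
  have l1 : lam < 1 by near: lam; exact: nbhs_right_lt.
  suff: h lam != s -> h lam \in I -> A (h lam).
    by apply; [rewrite -subr_eq0 hB mulf_neq0// gt_eqF|exact: hI].
  by near: lam.
have dl : (g (h lam) - g s) / (h lam - s) @[lam --> 0^'+] --> derive_in I g s.
  exact: cvg_trans (cvg_app _ hs) dg.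
have dl' : (g (h lam) - g s) / (h lam - s) * (t - s) @[lam --> 0^'+] -->
    derive_in I g s * (t - s).
  by apply: cvgM => //; exact: cvg_cst.
apply: (cvgr_to_le dl'); near=> lam.
have l0 : 0 < lam by near: lam; exact: nbhs_right_gt.
have l1 : lam < 1 by near: lam; exact: nbhs_right_lt.
have -> : (g (h lam) - g s) / (h lam - s) * (t - s) = (g (h lam) - g s) / lam.
  by rewrite hB; field; rewrite ts gt_eqF.
rewrite ler_pdivrMr// lerBlDr.
have := cg (Itv01 (ltW l0) (ltW l1)) t s.
rewrite !inE /= => /(_ tI sI); rewrite !convRE /= /unstable.onem.
rewrite -[X in g X <= _]/(lam * t + (1 - lam) * s).
have -> : lam * t + (1 - lam) * s = h lam by rewrite /h; ring.
by move=> /le_trans; apply; lra.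
Unshelve. all: by end_near.
Qed.

End Convexity.

(** * Energy stability *)

Theorem theorem5p1 (R : realType) (d : nat) (hd : d = 2%N \/ d = 3%N)
  (I : interval R) (f : 'cV[R]_d -> R -> R)
  (f_pos : forall n s, sphere n -> 0 < f n s)
  (hf : energy_density_assumption f I)
  (k0 : 'cV[R]_d -> R -> R) (hk0 : threshold f I k0)
  (G : mesh R d) (hG : closed_oriented_surface G)
  (N : 'cV[R]_d -> 'cV[R]_d)
  (normal_sum_neq0 : forall i : 'I_(nvert G), normal_sum G i != 0)
  (hN : interpolates_vertex_normals G N)
  (H : 'cV[R]_d -> R) (hH : fe_space G H)
  (tau : R) (tau_gt0 : 0 < tau)
  (X : 'cV[R]_d -> 'cV[R]_d) (mu H' r : 'cV[R]_d -> R)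
  (hX : fe_space_vec G X) (hmu : fe_space G mu)
  (hH' : fe_space G H') (hr : fe_space G r)
  (k : 'cV[R]_d -> R -> R)
  (k_ge0 : forall n s, sphere n -> s \in I -> 0 <= k n s)
  (k_ge_k0 : forall (j : 'I_(nelem G)) (l : 'I_d),
    k0 (elem_normal G j) (H' (elem G j l)) <=
    k (elem_normal G j) (H' (elem G j l)))
  (eq_X : forall phi, fe_space G phi ->
    quad_scal G (fun j l => dot (tau^-1 *: (X (elem G j l) - elem G j l))
                              (elem_normal G j))
              (nodal_traces G phi)
    = - quad_scal G (nodal_traces G mu) (nodal_traces G phi))
  (eq_mu : forall omega, fe_space_vec G omega ->
    quad_vec G (fun j l => mu (elem G j l) *: elem_normal G j)
      (nodal_traces G omega)
    = D_form G f k X omega H' + B_form G N omega r)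
  (eq_H : forall psi, fe_space G psi ->
    quad_scal G (nodal_traces G (fun x => H' x - H x)) (nodal_traces G psi)
    = B_form G N (fun x => X x - x) psi)
  (eq_r : forall zeta, fe_space G zeta ->
    quad_scal G (nodal_traces G r) (nodal_traces G zeta)
    = quad_scal G (fun j l => fH f I (elem_normal G j) (H' (elem G j l)))
                (nodal_traces G zeta))
  (nondeg : forall j : 'I_(nelem G), nondegenerate_simplex (elem G j))
  (nondeg' : forall j : 'I_(nelem (mesh_image X G)),
    nondegenerate_simplex (elem (mesh_image X G) j))
  (H_in : forall i : 'I_(nvert G), H (vert G i) \in I)
  (H'_in : forall i : 'I_(nvert G), H' (vert G i) \in I) :
  discrete_energy (mesh_image X G) f (fun i => H' (vert G i))
    + tau * quad_scal G (nodal_traces G mu) (nodal_traces G mu)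
  <= discrete_energy G f (fun i => H (vert G i)).
Proof.
have fe_id := fe_space_vec_id G.
have fe_dX := fe_space_vecB hX fe_id.
have fe_dH := fe_spaceB hH' hH.
set E := quad_scal G (nodal_traces G mu) (nodal_traces G mu).
have energy_balance : - (tau * E) = D_form G f k X (fun x => X x - x) H' +
    quad_scal G (fun j l => fH f I (elem_normal G j) (H' (elem G j l)))
                (nodal_traces G (fun x => H' x - H x)).
  rewrite -(eq_r _ fe_dH) quad_scalC (eq_H _ hr) -(eq_mu _ fe_dX).
  rewrite -mulrN -(eq_X _ hmu) /quad_scal /quad_vec /quad mulrCA.
  congr (_ * _); rewrite mulr_sumr; apply: eq_bigr => j _.
  rewrite mulr_sumr; apply: eq_bigr => l _.
  rewrite /nodal_traces (dotZl (mu _)) (dotZl tau^-1) (dotC (elem_normal G j)).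
  by field; rewrite gt_eqF.
rewrite -lerBrDr -lerBlDl [X in _ <= X]energy_balance.
rewrite /discrete_energy /D_form /quad_mat /quad_scal /quad -mulrBr -mulrDr.
apply: ler_wpM2l; first by rewrite invr_ge0 ler0n.
rewrite -sumrB -big_split /=; apply: ler_sum => j _.
rewrite !mulr_sumr -sumrB -big_split /=; apply: ler_sum => l _.
have Xj i : affine_on (simplex (elem G j)) (fun x => X x i 0) by case: (hX i).
have := hk0.2 _ (H'_in (conn G j l)) _ _ (nondeg j) Xj (nondeg' j) _ (k_ge_k0 j l).
rewrite (tjacB hd (nondeg j) Xj) => [threshold_jl|i]; last exact: affine_on_coord.
have [_ _ _ fC1 fconv] := hf.
have nj := sphere_unit_normal hd (nondeg j).
have convexity_jl := convex_tangent_line (fconv _ nj)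
  ((fC1 _ nj).1 _ (H'_in (conn G j l))) (H'_in (conn G j l)) (H_in (conn G j l)).
have {convexity_jl} : smeas (elem G j) * f (elem_normal G j) (H' (elem G j l)) -
    smeas (elem G j) * f (elem_normal G j) (H (elem G j l)) <=
    smeas (elem G j) * (fH f I (elem_normal G j) (H' (elem G j l)) *
      (H' (elem G j l) - H (elem G j l))).
  rewrite -mulrBr; apply: ler_wpM2l; first exact: ltW (nondeg j).
  rewrite -lerN2 -mulrN !opprB.
  exact: convexity_jl.
(* The energies of the intermediate state (old normal, new H') cancel. *)
move=> /(lerD threshold_jl); rewrite addrA subrK; exact.
Qed.
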